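(* Let $n, t$ be positive integers with $t \le n$ and let $\mathcal{A}, \mathcal{B} \subseteq \mathcal{P}([n])$ be such that the pair $(\mathcal{A}, \mathcal{B})$ is $t$-cross-avoiding, i.e. $|A \cap B| \ne t$ for all $A \in \mathcal{A}$, $B \in \mathcal{B}$. Then $$d(\mathcal{A}, \mathcal{B}) \le \sum_{k=0}^{t-1} \binom{n}{k} 2^{n-k}.$$
   Context: $[n] = \{1, \ldots, n\}$ and $\mathcal{P}([n])$ is its power set. For $\mathcal{A}, \mathcal{B} \subseteq \mathcal{P}([n])$, $d(\mathcal{A}, \mathcal{B})$ is the number of pairs $(A,B) \in \mathcal{A} \times \mathcal{B}$ with $A \cap B = \varnothing$. *)

(* Defs.v *)
From mathcomp Require Import all_boot.

Set Implicit Arguments.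
Unset Strict Implicit.
Unset Printing Implicit Defensive.

(* The ground set [n] = {1, ..., n} is represented by 'I_n. *)

Definition disjoint_pairs (n : nat) (A B : {set {set 'I_n}}) : nat :=
  #|[set p : {set 'I_n} * {set 'I_n} |
      [&& p.1 \in A, p.2 \in B & p.1 :&: p.2 == set0]]|.

Definition cross_avoiding (n t : nat) (A B : {set {set 'I_n}}) : Prop :=
  forall X Y : {set 'I_n}, X \in A -> Y \in B -> #|X :&: Y| <> t.

(* Main.v *)
Require Import Defs.
From mathcomp Require Import all_boot.

(** Induction on the size of the ground set.  Fix a point [x] and split each
    family along it: [A0] consists of the members of [A] missing [x], [A1] of
    the members containing [x], with [x] removed, and likewise for [B].  Write
    [D i j] for the set of disjoint pairs of [A_i] and [B_j].  A disjoint pair of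
    [A] and [B] cannot have [x] on both sides, so
    [d(A, B) = |D 0 0| + |D 1 0| + |D 0 1|].  Applying inclusion-exclusion twice,
    this sum equals
    [|D 0 0 :|: D 1 0| + |D 0 1 :|: (D 0 0 :&: D 1 0)| + |D 0 0 :&: D 1 0 :&: D 0 1|].
    - The first set consists of disjoint pairs of [A0 :|: A1] and [B0].  This
      pair is [t]-cross-avoiding, because no member of [B0] contains [x].
    - The second lies among the disjoint pairs of [A0] and [B0 :|: B1], which is
      [t]-cross-avoiding because no member of [A0] contains [x].
    - The third consists of disjoint pairs of [A0 :&: A1] and [B0 :&: B1], and
      this pair is [t-1]-cross-avoiding: adding [x] to both of two members
      raises the size of their intersection by one.
    So [d(A, B)] on [n+1] points is at most twice the bound for [(n, t)] plus the
    bound for [(n, t-1)], which is exactly the recurrence [avoiding_boundS] of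
    the right-hand side.  The splitting is [card_dpairs_split], and the avoidance
    claims are [avoids_del] and [avoids_link]. *)

Set Implicit Arguments.
Unset Strict Implicit.
Unset Printing Implicit Defensive.

Definition avoiding_bound (n t : nat) : nat :=
  \sum_(0 <= k < t) 'C(n, k) * 2 ^ (n - k).

(** Pascal's rule, weighted: the bound counts the words in [{0,1,2}^n] with fewer
    than [t] letters 1, and the recurrence sorts them by their last letter. *)
Lemma avoiding_boundS n t :
  avoiding_bound n.+1 t.+1
    = avoiding_bound n t.+1 + avoiding_bound n t.+1 + avoiding_bound n t.
Proof.
rewrite addnn -mul2n /avoiding_bound !big_nat_recl // !bin0 !mul1n !subn0 expnS.
rewrite mulnDr -addnA; congr (_ + _); rewrite big_distrr -big_split /=.
apply: eq_bigr => k _; rewrite binS subSS mulnDl; congr (_ + _).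
have [ltkn|lenk] := ltnP k n; last by rewrite bin_small // muln0.
by rewrite mulnCA -expnS -subSn // subSS.
Qed.

Section DisjointPairs.

Variable T : finType.
Implicit Types (x : T) (A B : {set {set T}}) (U X Y : {set T}).

Definition dpairs A B : {set {set T} * {set T}} :=
  [set p | [&& p.1 \in A, p.2 \in B & p.1 :&: p.2 == set0]].

Definition avoids (t : nat) A B : Prop :=
  forall X Y, X \in A -> Y \in B -> #|X :&: Y| <> t.

Lemma dpairsP A B X Y :
  ((X, Y) \in dpairs A B) = [&& X \in A, Y \in B & X :&: Y == set0].
Proof. by rewrite inE. Qed.

Lemma dpairsUl A1 A2 B : dpairs (A1 :|: A2) B = dpairs A1 B :|: dpairs A2 B.
Proof. by apply/setP=> -[X Y]; rewrite !inE /= andb_orl. Qed.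

Lemma dpairsI A1 A2 B1 B2 :
  dpairs (A1 :&: A2) (B1 :&: B2) = dpairs A1 B1 :&: dpairs A2 B2.
Proof.
apply/setP=> -[X Y]; rewrite !inE /=.
by case: (X \in A1) (X \in A2) (Y \in B1) (Y \in B2) (_ == _) => [] [] [] [] [].
Qed.

Lemma dpairsS A1 A2 B1 B2 :
  A1 \subset A2 -> B1 \subset B2 -> dpairs A1 B1 \subset dpairs A2 B2.
Proof.
move=> /subsetP sA /subsetP sB; apply/subsetP=> -[X Y]; rewrite !dpairsP.
by case/and3P=> /sA-> /sB->.
Qed.

Definition del x A : {set {set T}} := [set X : {set T} in A | x \notin X].
Definition link x A : {set {set T}} 
  := [set X : {set T} | (x \notin X) && (x |: X \in A)].

Lemma del_sub x U A : A \subset powerset U -> del x A \subset powerset (U :\ x).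
Proof.
move=> /subsetP sAU; apply/subsetP=> X; rewrite !inE subsetD1 => /andP[XA ->].
by move/sAU: XA; rewrite inE andbT.
Qed.

Lemma link_sub x U A : A \subset powerset U -> link x A \subset powerset (U :\ x).
Proof.
move=> /subsetP sAU; apply/subsetP=> X; rewrite !inE subsetD1 => /andP[-> XA].
by move/sAU: XA; rewrite inE subUset andbT => /andP[].
Qed.

(** A disjoint pair has [x] in at most one of its two members. *)
Lemma card_dpairs_split x A B :
  #|dpairs A B| <= #|dpairs (del x A) (del x B)| + #|dpairs (link x A) (del x B)|
                   + #|dpairs (del x A) (link x B)|.
Proof.
set D0 := dpairs (del x A) _; set D1 := dpairs (link x A) _.
set D2 := dpairs _ (link x B).
pose addl (p : {set T} * {set T}) := (x |: p.1, p.2).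
pose addr (p : {set T} * {set T}) := (p.1, x |: p.2).
have sub : dpairs A B \subset D0 :|: addl @: D1 :|: addr @: D2.
  apply/subsetP=> -[X Y]; rewrite dpairsP => /and3P[XA YB dXY].
  have [xX|xX] := boolP (x \in X); have [xY|xY] := boolP (x \in Y).
  - by have := in_set0 x; rewrite -(eqP dXY) inE xX xY.
  - rewrite !in_setU; apply/orP; left; apply/orP; right.
    apply/imsetP; exists (X :\ x, Y); last by rewrite /addl /= setD1K.
    rewrite dpairsP !inE eqxx setD1K // XA YB xY /= -subset0.
    by rewrite -(eqP dXY) setSI // subsetDl.
  - rewrite !in_setU; apply/orP; right.
    apply/imsetP; exists (X, Y :\ x); last by rewrite /addr /= setD1K.
    rewrite dpairsP !inE eqxx setD1K // XA YB xX /= -subset0.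
    by rewrite -(eqP dXY) setIS // subsetDl.
  - by rewrite !in_setU dpairsP !inE XA YB xX xY dXY.
apply: leq_trans (subset_leq_card sub) _.
apply: leq_trans (leq_card_setU _ _) (leq_add _ (leq_imset_card _ _)).
exact: leq_trans (leq_card_setU _ _) (leq_add _ (leq_imset_card _ _)).
Qed.

Lemma avoidsC t A B : avoids t A B -> avoids t B A.
Proof. by move=> av X Y XB YA; rewrite setIC; apply: av. Qed.

(** A point is invisible to the intersection with a set that misses it. *)
Lemma avoids_del x t A B :
  avoids t A B -> avoids t (del x A :|: link x A) (del x B).
Proof.
move=> av X Y; rewrite !inE => /orP[] /andP[].
  by move=> XA _ /andP[YB _]; apply: av.
move=> xX XA /andP[YB xY]; have := av _ _ XA YB.
rewrite setIUl (_ : [set x] :&: Y = set0) ?set0U //.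
by apply/eqP; rewrite setI_eq0 disjoints1.
Qed.

Lemma avoids_link x t A B :
  avoids t.+1 A B -> avoids t (link x A) (link x B).
Proof.
move=> av X Y; rewrite !inE => /andP[xX XA] /andP[xY YB].
have := av _ _ XA YB; rewrite -setUIr cardsU1 inE negb_and xX /= add1n.
by move=> neq eq; apply: neq; rewrite eq.
Qed.

Lemma dpairs_avoids0 A B : avoids 0 A B -> dpairs A B = set0.
Proof.
move=> av; apply/setP=> -[X Y]; rewrite dpairsP inE.
by apply/and3P=> -[XA YB /eqP dXY]; apply: (av X Y XA YB); rewrite dXY cards0.
Qed.

(** The ground set is a subset [U] of a fixed type so that the induction can
    remove a point without changing types, and [t = 0] is included because the
    [link] families avoid one intersection size lower. *)
Theorem card_dpairs_avoids U t A B :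
    A \subset powerset U -> B \subset powerset U -> avoids t A B ->
  #|dpairs A B| <= avoiding_bound #|U| t.
Proof.
move: {2}#|U| (erefl #|U|) => n.
elim: n U t A B => [|n IH] U t A B cU sAU sBU av; case: t av => [|t] av.
1,3: by rewrite dpairs_avoids0 // cards0.
(* On an empty ground set the only pair is made of two empty sets. *)
- move/eqP: (cU) sAU sBU; rewrite cards_eq0 cU => /eqP->.
  rewrite powerset0 => /subsetP sA /subsetP sB.
  apply: (@leq_trans 1); last by rewrite /avoiding_bound big_nat_recl // bin0.
  rewrite -(cards1 (set0 : {set T}, set0 : {set T})); apply/subset_leq_card/subsetP.
  move=> -[X Y]; rewrite dpairsP inE => /and3P[/sA + /sB + _].
  by rewrite !inE => /eqP-> /eqP->.
have [x xU] : exists x, x \in U by apply/set0Pn; rewrite -card_gt0 cU.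
have cU' : #|U :\ x| = n by move: cU; rewrite (cardsD1 x) xU => -[].
have av_del := avoids_del (x := x) av.
have av_delC := avoidsC (avoids_del (x := x) (avoidsC av)).
have av_link := avoids_link (x := x) av.
rewrite cU avoiding_boundS.
apply: leq_trans (card_dpairs_split x A B) _.
move: av_del av_delC av_link.
have := del_sub x sAU; have := del_sub x sBU; have := link_sub x sAU; have := link_sub x sBU.
set A0 := del x A; set B0 := del x B; set A1 := link x A; set B1 := link x B.
move=> sB1 sA1 sB0 sA0 av_del av_delC av_link.
(* The sum becomes |D 0 0 :|: D 1 0| + |D 0 1 :|: I| + |D 0 1 :&: I| with
   I = D 0 0 :&: D 1 0. *)
rewrite -cardsUI -addnA [X in _ + X]addnC -cardsUI addnA.
rewrite -dpairsUl -!dpairsI setIid setIA setIid [B1 :&: B0]setIC -cU'.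
rewrite leq_add ?leq_add //.
- by apply: IH; rewrite // subUset sA0.
- apply: (@leq_trans #|dpairs A0 (B0 :|: B1)|).
    apply/subset_leq_card; rewrite subUset.
    by rewrite !dpairsS ?subsetUl ?subsetUr ?subsetIl.
  by apply: IH; rewrite // subUset sB0.
- apply: IH => //.
  + exact: subset_trans (subsetIl _ _) sA0.
  + exact: subset_trans (subsetIl _ _) sB0.
  + by move=> X Y /setIP[_ XA1] /setIP[_ YB1]; apply: av_link.
Qed.

End DisjointPairs.

Theorem theorem1p2 (n t : nat) (A B : {set {set 'I_n}}) :
  0 < n -> 0 < t -> t <= n ->
  cross_avoiding t A B ->
  disjoint_pairs A B <= \sum_(0 <= k < t) 'C(n, k) * 2 ^ (n - k).
Proof.
move=> _ _ _ av; rewrite -[n in X in _ <= X](card_ord n) -cardsT.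
by apply: card_dpairs_avoids; rewrite ?powersetT ?subsetT.
Qed.
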